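(* Let $k\ge 0$ be an integer and $n=48k+46$; all arithmetic is modulo $n$. Define $c_1(r)=r$ for $0\le r\le n-1$. Define $c_2,c_3:\{0,\dots,n-1\}\to\mathbb{Z}_n$ by: for $0\le i\le 12k+11$, $c_2(2i)=6k+5+i(12k+12)$ and $c_3(2i)=6k+6+i(12k+13)$; for $0\le i\le 12k+10$, $c_2(2i+1)=12k+11+i(12k+12)$ and $c_3(2i+1)=24k+24+i(12k+13)$; and for $0\le r\le 24k+22$ and $\alpha=2,3$, $c_\alpha(n-1-r)=n-1-c_\alpha(r)$. For $\alpha=1,2,3$ let ${\cal L}_\alpha=[l_\alpha(r,j)]$ be the $n\times n$ array with $l_\alpha(r,j)\equiv c_\alpha(r)+j\pmod n$, $0\le r,j\le n-1$. Then ${\cal L}_1,{\cal L}_2,{\cal L}_3$ are three (cyclic) mutually nearly orthogonal Latin squares of order $n$, i.e. they are Latin squares and each pair of them is nearly orthogonal.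
   Context: A Latin square of order $n$ is an $n\times n$ array in which each row and each column contains each of the symbols $0,\dots,n-1$ exactly once. For Latin squares $L=[l(i,j)]$ and $M=[m(i,j)]$ of even order $n$ on symbols $\{0,\dots,n-1\}$, their superimposition is the $n\times n$ array $A=[(l(i,j),m(i,j))]$. $L$ and $M$ are nearly orthogonal if in $A$ every ordered pair $(x,y)$ with $0\le x,y\le n-1$, $x\ne y$, occurs at least once, and each ordered pair $(x,x+n/2)$ (second coordinate taken modulo $n$) occurs exactly twice. A set of Latin squares is mutually nearly orthogonal if every two of them are nearly orthogonal. *)

(* Defs.v *)
From mathcomp Require Import all_boot all_order all_algebra.

Set Implicit Arguments.
Unset Strict Implicit.
Unset Printing Implicit Defensive.

Section NearlyOrthogonal.

Variable n : nat.

Definition latin_square (L : 'M['I_n]_n) : Prop :=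
  (forall i x, exists! j, L i j = x) /\ (forall j x, exists! i, L i j = x).

Definition superimposition (L M : 'M['I_n]_n) : 'M['I_n * 'I_n]_n :=
  \matrix_(i, j) (L i j, M i j).

Definition occurrences (A : 'M['I_n * 'I_n]_n) (xy : 'I_n * 'I_n) : nat :=
  #|[set ij : 'I_n * 'I_n | A ij.1 ij.2 == xy]|.

Definition nearly_orthogonal (L M : 'M['I_n]_n) : Prop :=
  [/\ ~~ odd n,
      forall x y : 'I_n, x != y ->
        0 < occurrences (superimposition L M) (x, y)
    & forall x y : 'I_n, y = x + n./2 %[mod n] ->
        occurrences (superimposition L M) (x, y) = 2].

Definition mutually_nearly_orthogonal_latin_squares
    (m : nat) (Ls : m.-tuple 'M['I_n]_n) : Prop :=
  (forall a : 'I_m, latin_square (tnth Ls a)) /\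
  (forall a b : 'I_m, a != b -> nearly_orthogonal (tnth Ls a) (tnth Ls b)).

(* The array with entries c(r) + j mod n.  The positivity of n needed to
   reduce mod n is extracted from the row index r : 'I_n. *)
Definition cyclic_array (c : nat -> nat) : 'M['I_n]_n :=
  \matrix_(r < n, j < n)
    Ordinal (ltn_pmod (c r + j) (leq_ltn_trans (leq0n r) (ltn_ord r))).

(* Extends h from the rows 0 <= r < n/2 to all rows 0 <= r < n by
   c(n-1-r) = n-1-c(r).  Elements of Z_n are represented by their residues in
   {0, ..., n-1}, so that no natural-number subtraction truncates. *)
Definition reflected_column (h : nat -> nat) (r : nat) : nat :=
  if r < n./2 then h r %% n else n.-1 - h (n.-1 - r) %% n.

End NearlyOrthogonal.

Definition c1 (r : nat) : nat := r.

(* In c2 and c3, r./2 is the i such that r = 2i or r = 2i+1. *)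
Definition c2 (k : nat) : nat -> nat :=
  reflected_column (48 * k + 46) (fun r =>
    if odd r then 12 * k + 11 + r./2 * (12 * k + 12)
    else 6 * k + 5 + r./2 * (12 * k + 12)).

Definition c3 (k : nat) : nat -> nat :=
  reflected_column (48 * k + 46) (fun r =>
    if odd r then 24 * k + 24 + r./2 * (12 * k + 13)
    else 6 * k + 6 + r./2 * (12 * k + 13)).

(* Main.v *)
(** Row r of the superimposition of the cyclic arrays of c and c' contains each
    pair (x, y) with y - x = c'(r) - c(r) modulo n exactly once, so near
    orthogonality says that the differences D(r) = c'(r) - c(r) hit every
    nonzero residue, and n/2 twice.  By the reflection rule D(n-1-r) = -D(r), it
    suffices that the first n/2 rows hit every residue of {1, ..., n/2} up to
    sign and up to multiplication by a unit a.  With t = k + 1, so that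
    n = 48t - 2, the closed form c2(r) = 6t(r+1) - 1 on the first half gives
    - c2 - c1 = (6t-1)(r+1);
    - c3 - c1 = -(12t-1)e with e = 12t - i for r = 2i, 24t - 1 - i for r = 2i+1;
    - c3 - c2 = e with e = 1 + i for r = 2i, 12t + 1 + i for r = 2i+1. *)

Require Import Defs.
From mathcomp Require Import all_boot all_order all_algebra.
From mathcomp Require Import zify ring.

Set Implicit Arguments.
Unset Strict Implicit.
Unset Printing Implicit Defensive.

Import GRing.Theory Num.Theory.

(** * Latin squares and occurrence counts in a superimposition *)

Lemma injective_exists_unique (T : finType) (f : T -> T) :
  injective f -> forall y, exists! x, f x = y.
Proof.
move=> f_inj y; exists (invF f_inj y); split; first exact: f_invF.
by move=> x <-; rewrite invF_f.
Qed.

Lemma cyclic_array_latin (n : nat) (c : nat -> nat) :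
  (forall r s, r < n -> s < n -> c r = c s %[mod n] -> r = s) ->
  latin_square (cyclic_array n c).
Proof.
move=> c_inj; split=> [r x|j x]; apply: injective_exists_unique => i1 i2;
  rewrite !mxE => /(congr1 val) /= /eqP.
- by rewrite eqn_modDl !modn_small // => /eqP/val_inj.
- by rewrite eqn_modDr => /eqP /(c_inj _ _ (ltn_ord _) (ltn_ord _)) /val_inj.
Qed.

(** Each row has [x] in exactly one column of [L], and that cell fixes [y], so each row contributes
    1. *)
Lemma sum_occurrences_latin (n : nat) (L M : 'M['I_n]_n) (x : 'I_n) :
  latin_square L -> \sum_(y < n) occurrences (superimposition L M) (x, y) = n.
Proof.
move=> [rowL _].
transitivity (\sum_(i < n) \sum_(j < n) \sum_(y < n)
    ((L i j == x) && (M i j == y) : nat)).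
  under eq_bigr => y _ do
    rewrite /occurrences -sum1dep_card big_mkcond /=.
  rewrite (eq_bigr (fun y => \sum_(i < n) \sum_(j < n)
    ((L i j == x) && (M i j == y) : nat))); last first.
    move=> y _; rewrite pair_big /=; apply: eq_bigr => -[i j] _ /=.
    by rewrite mxE xpair_eqE; case: (_ && _).
  rewrite exchange_big /=; apply: eq_bigr => i _.
  by rewrite exchange_big.
transitivity (\sum_(i < n) 1); last by rewrite sum_nat_const card_ord muln1.
apply: eq_bigr => i _.
have [j0 [Lj0 j0_unique]] := rowL i x.
rewrite (bigD1 j0) //= [X in _ + X]big1 => [|j jNj0].
  rewrite (bigD1 (M i j0)) //= Lj0 !eqxx /= big1 // => y.
  by rewrite eq_sym => /negbTE ->.
rewrite big1 // => y _; case: eqP => //= Lj.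
by rewrite (j0_unique j Lj) eqxx in jNj0.
Qed.

(* The lower bounds suffice: row by row they already account for all
   1 * (n - 2) + 2 = n occurrences of x. *)
Lemma nearly_orthogonal_of_ge (n : nat) (L M : 'M['I_n]_n) :
  ~~ odd n -> latin_square L ->
  (forall x y : 'I_n, x != y -> 0 < occurrences (superimposition L M) (x, y)) ->
  (forall x y : 'I_n, y = x + n./2 %[mod n] ->
    1 < occurrences (superimposition L M) (x, y)) ->
  nearly_orthogonal L M.
Proof.
move=> n_even latL occ1 occ2; split=> // x y xy.
apply/eqP; rewrite eqn_leq occ2 // andbT.
have yNx : y != x.
  apply/eqP => yx; move: xy (ltn_ord x); rewrite yx => /esym/eqP.
  rewrite -[X in _ == X %[mod _]]addn0 eqn_modDl => /eqP.
  by move=> + n_gt0; rewrite !modn_small; lia.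
have := sum_occurrences_latin M x latL.
rewrite (bigD1 y) //= (bigD1 x) /=; last by rewrite eq_sym.
set S := (X in _ + (_ + X)).
suff : n - 2 <= S by have := ltn_ord x; lia.
apply: (@leq_trans (\sum_(i < n | (i != y) && (i != x)) 1)).
  rewrite sum1dep_card.
  have -> : [set i | (i != y) && (i != x)] = ~: [set y; x].
    by apply/setP => i; rewrite !inE negb_or.
  by rewrite cardsCs setCK card_ord cards2 yNx.
by apply: leq_sum => i /andP[_ iNx]; apply: occ1; rewrite eq_sym.
Qed.

(** For even [n], [n./2] is its own negative modulo [n], so the doubled pairs are stable under
    swapping. Hence one order of each pair of squares suffices. *)
Lemma nearly_orthogonal_sym (n : nat) (L M : 'M['I_n]_n) :
  nearly_orthogonal L M -> nearly_orthogonal M L.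
Proof.
have occC x y : occurrences (superimposition M L) (x, y) =
                occurrences (superimposition L M) (y, x).
  by congr #|pred_of_set _|; apply/setP => ij; rewrite !inE !mxE !xpair_eqE andbC.
move=> [n_even occ1 occ2]; split=> // x y xy; rewrite occC.
  by apply: occ1; rewrite eq_sym.
apply: occ2; rewrite -modnDml xy modnDml -addnA addnn halfK (negbTE n_even) subn0.
by rewrite modnDr.
Qed.

(** * Near orthogonality of cyclic arrays through row differences *)

Lemma dvdz_small_eq0 (n : nat) (d : int) :
  (n%:Z %| d)%Z -> `|d|%N < n -> d = 0%R.
Proof.
rewrite dvdzE /= => n_dvd d_lt; have := gtnNdvd _ d_lt.
by rewrite n_dvd; lia.
Qed.

(** Along a row both entries shift by the same [j], so their difference is constant; the column
    where the first entry is [x] must then have second entry [y]. *)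
Lemma superimposition_cyclic_array_hits (n : nat) (c c' : nat -> nat)
    (r x y : 'I_n) :
  latin_square (cyclic_array n c) ->
  (n%:Z %| ((c' r)%:Z - (c r)%:Z - ((y : nat)%:Z - (x : nat)%:Z))%R)%Z ->
  exists j, superimposition (cyclic_array n c) (cyclic_array n c') r j = (x, y).
Proof.
move=> [rowL _] /dvdzP[q Dq]; have [j [Lj _]] := rowL r x.
exists j; rewrite mxE Lj; congr (_, _); apply: val_inj.
move: Lj; rewrite !mxE /= => /(congr1 val) /= Lj.
rewrite -[RHS](modn_small (ltn_ord y)); apply/eqP.
have := divn_eq (c r + j) n; rewrite Lj => Dj.
rewrite -eqz_nat -!modz_nat eqz_mod_dvd; apply/dvdzP.
exists (q + ((c r + j) %/ n)%:Z)%R; lia.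
Qed.

(* As D(n-1-r) = -D(r) for the differences D = c' - c, rho indexes the rows of
   the first half by the representatives 1 <= e <= n/2 of the nonzero residues
   up to sign; the residue n/2 is its own opposite, hence is hit twice. *)
Lemma cyclic_array_nearly_orthogonal
    (n : nat) (a : int) (c c' rho : nat -> nat) :
  ~~ odd n -> coprimez n%:Z a -> latin_square (cyclic_array n c) ->
  (forall r, r < n -> c r + c (n.-1 - r) = n.-1) ->
  (forall r, r < n -> c' r + c' (n.-1 - r) = n.-1) ->
  (forall e : nat, 0 < e <= n./2 -> rho e < n./2 /\
    (n%:Z %| ((c' (rho e))%:Z - (c (rho e))%:Z - a * e%:Z)%R)%Z) ->
  nearly_orthogonal (cyclic_array n c) (cyclic_array n c').
Proof.
move=> n_even co_na latL c_refl c'_refl rhoP.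
have hit_pos e (x y : 'I_n) : 0 < e <= n./2 ->
    (n%:Z %| (y%:Z - x%:Z - a * e%:Z)%R)%Z ->
    exists ij, superimposition (cyclic_array n c) (cyclic_array n c')
      ij.1 ij.2 = (x, y) /\ ij.1 = rho e :> nat.
  move=> e_bd dvd_e; have [rho_lt dvd_rho] := rhoP e e_bd.
  have rho_n : rho e < n by lia.
  have [|j Aj] := @superimposition_cyclic_array_hits n c c' (Ordinal rho_n) x y latL.
    have /= := rpredB dvd_rho dvd_e.
    by congr (_ %| _)%Z; lia.
  by exists (Ordinal rho_n, j).
have hit_neg e (x y : 'I_n) : 0 < e <= n./2 ->
    (n%:Z %| (y%:Z - x%:Z + a * e%:Z)%R)%Z ->
    exists ij, superimposition (cyclic_array n c) (cyclic_array n c')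
      ij.1 ij.2 = (x, y) /\ ij.1 = n.-1 - rho e :> nat.
  move=> e_bd dvd_e; have [rho_lt dvd_rho] := rhoP e e_bd.
  have rho_n : n.-1 - rho e < n by lia.
  have [|j Aj] := @superimposition_cyclic_array_hits n c c' (Ordinal rho_n) x y latL.
    rewrite /= -rpredN; have /= := rpredD dvd_rho dvd_e.
    have rho_lt' : rho e < n by lia.
    have := c_refl _ rho_lt'; have := c'_refl _ rho_lt'.
    by move=> ? ?; congr (_ %| _)%Z; lia.
  by exists (Ordinal rho_n, j).
have /coprimezP[[u v] /= Duv] := co_na.
apply: nearly_orthogonal_of_ge => // x y xy.
(* By the Bezout relation [v] inverts [a], so [w] is the residue with a w = y - x modulo n. If it
   exceeds n/2, the mirrored row is used with e = n - w. *)
- pose w := ((v * (y%:Z - x%:Z))%R %% n%:Z)%Z.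
  have n_gt0 : 0 < n by have := ltn_ord x; lia.
  have w_ge0 : (0 <= w)%R by apply: modz_ge0; lia.
  have w_lt : (w < n%:Z)%R by apply: ltz_pmod; lia.
  have /dvdzP[q Dq] : (n%:Z %| (y%:Z - x%:Z - a * w)%R)%Z.
    apply/dvdzP; exists (u * (y%:Z - x%:Z) + a * ((v * (y%:Z - x%:Z))%R %/ n%:Z)%Z)%R.
    have := divz_eq (v * (y%:Z - x%:Z))%R n%:Z; rewrite -/w => Dw.
    have -> : (w = v * (y%:Z - x%:Z) - ((v * (y%:Z - x%:Z))%R %/ n%:Z)%Z * n%:Z)%R.
      by rewrite [X in (X - _)%R]Dw; ring.
    rewrite -[X in (X - _)%R = _]mul1r -Duv; ring.
  have w_neq0 : w <> 0%R.
    move=> w0; move: Dq; rewrite w0 mulr0 subr0 => Dq.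
    have q0 : q = 0%R.
      have := ltn_ord x; have := ltn_ord y; move: Dq => /= Dq; nia.
    by move/eqP: xy; apply; apply: val_inj => /=; move: Dq; rewrite q0; lia.
  rewrite /occurrences card_gt0; apply/set0Pn.
  case: (lerP w (n./2)%:Z%R) => w_half.
    have [||ij [Aij _]] := hit_pos `|w|%N x y; first lia; last first.
      by exists ij; rewrite inE Aij.
    by apply/dvdzP; exists q; rewrite -Dq gez0_abs.
  have [||ij [Aij _]] := hit_neg `|(n%:Z - w)%R|%N x y; first lia; last first.
    by exists ij; rewrite inE Aij.
  apply/dvdzP; exists (q + a)%R.
  rewrite gez0_abs; last lia.
  by rewrite mulrDl -Dq; ring.
have h_bd : 0 < n./2 <= n./2 by have := ltn_ord x; lia.
have n_half : (n%:Z = (n./2)%:Z * 2)%R by lia.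
(* A unit modulo an even [n] is odd, hence a (n/2) = n/2 = -a (n/2) modulo n: the row [rho n./2] and
   its mirror image both hit the pair. *)
have [b Db] : exists b, a = (2 * b + 1)%R.
  exists (a %/ 2)%Z; have := divz_eq a 2.
  have : ((a %% 2)%Z = 0 \/ (a %% 2)%Z = 1)%R by lia.
  case=> -> Da; last lia.
  move: Duv; rewrite Da n_half; lia.
have [q Dq] : exists q, (y%:Z - x%:Z - (n./2)%:Z = q * n%:Z)%R.
  have Dx := divn_eq (x + n./2) n; have Dy := divn_eq y n.
  by exists ((y %/ n)%:Z - ((x + n./2) %/ n)%:Z)%R; rewrite mulrBl; lia.
have [|ij [Aij Dij]] := hit_pos _ x y h_bd.
  apply/dvdzP; exists (q - b)%R; rewrite mulrBl -Dq Db n_half; ring.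
have [|ij' [Aij' Dij']] := hit_neg _ x y h_bd.
  apply/dvdzP; exists (q + b + 1)%R; rewrite !mulrDl -Dq Db n_half; ring.
apply/card_gt1P; exists ij, ij'; split; rewrite ?inE ?Aij ?Aij' //.
apply/eqP => eq_ij; move: Dij; rewrite eq_ij Dij'.
by have [+ _] := rhoP _ h_bd; have := ltn_ord x; lia.
Qed.

(** * Columns extended by reflection *)

Lemma reflected_columnD (n : nat) (h : nat -> nat) (r : nat) :
  ~~ odd n -> r < n ->
  reflected_column n h r + reflected_column n h (n.-1 - r) = n.-1.
Proof.
move=> n_even r_lt; rewrite /reflected_column.
have n_gt0 : 0 < n by lia.
have h_lt s := ltn_pmod (h s) n_gt0.
case: ifP => r_half; case: ifP => r'_half; try lia.
  rewrite (_ : n.-1 - (n.-1 - r) = r); last lia.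
  by have := h_lt r; lia.
Qed.

Lemma reflected_column_half (n : nat) (h : nat -> nat) (r : nat) :
  r < n./2 -> exists q, h r = q * n + reflected_column n h r.
Proof.
by move=> r_half; exists (h r %/ n); rewrite /reflected_column r_half -divn_eq.
Qed.

(** Reflection turns a collision between rows of opposite halves into two rows of the first half
    whose values sum to n - 1. *)
Lemma reflected_latin (n : nat) (c : nat -> nat) :
  ~~ odd n ->
  (forall r, r < n -> c r + c (n.-1 - r) = n.-1) ->
  (forall r s, r < s < n./2 -> c r <> c s) ->
  (forall r s, r < n./2 -> s < n./2 -> c r + c s <> n.-1) ->
  latin_square (cyclic_array n c).
Proof.
move=> n_even c_refl c_neq c_sum.
have c_inj r s : r < n./2 -> s < n./2 -> c r = c s -> r = s.
  by case: (ltngtP r s) => // rs ? ? crs; [case: (c_neq r s) | case: (c_neq s r)];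
    rewrite ?rs.
apply: cyclic_array_latin => r s r_lt s_lt.
have cr := c_refl r r_lt; have cs := c_refl s s_lt.
rewrite !modn_small; [|lia|lia] => crs.
case: (ltnP r n./2) => r_half; case: (ltnP s n./2) => s_half.
- exact: c_inj.
- by case: (c_sum r (n.-1 - s)); lia.
- by case: (c_sum s (n.-1 - r)); lia.
- by have := c_inj (n.-1 - r) (n.-1 - s); lia.
Qed.

(** * Closed forms of the columns, and Latinity of the three squares *)

Section Columns.

Variable k : nat.

Let n := 48 * k + 46.

Let n_even : ~~ odd n. Proof. lia. Qed.
Let n_half : n./2 = 24 * k + 23. Proof. rewrite /n; lia. Qed.

(** Both parities form one progression of step 6k+6; the [+ 1] on the right avoids a subtraction. *)
Lemma c2_half (r : nat) : r < n./2 ->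
  exists q, 6 * (k + 1) * (r + 1) = q * n + c2 k r + 1.
Proof.
move=> r_half.
have [q Dq] : exists q, (if odd r then 12 * k + 11 + r./2 * (12 * k + 12)
    else 6 * k + 5 + r./2 * (12 * k + 12)) = q * n + c2 k r.
  exact: reflected_column_half _ r_half.
exists q; rewrite -Dq -[in LHS](odd_double_half r); case: (odd r); lia.
Qed.

Lemma c3_half_even (i : nat) : i < 12 * k + 12 ->
  exists q, 6 * k + 6 + i * (12 * k + 13) = q * n + c3 k i.*2.
Proof.
move=> i_lt; have i2_half : i.*2 < n./2 by lia.
have [q Dq] : exists q, (if odd i.*2 then 24 * k + 24 + i.*2./2 * (12 * k + 13)
    else 6 * k + 6 + i.*2./2 * (12 * k + 13)) = q * n + c3 k i.*2.
  exact: reflected_column_half _ i2_half.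
by exists q; rewrite -Dq odd_double doubleK.
Qed.

Lemma c3_half_odd (i : nat) : i < 12 * k + 11 ->
  exists q, 24 * k + 24 + i * (12 * k + 13) = q * n + c3 k i.*2.+1.
Proof.
move=> i_lt; have i2_half : i.*2.+1 < n./2 by lia.
have [q Dq] : exists q, (if odd i.*2.+1
    then 24 * k + 24 + i.*2.+1./2 * (12 * k + 13)
    else 6 * k + 6 + i.*2.+1./2 * (12 * k + 13)) = q * n + c3 k i.*2.+1.
  exact: reflected_column_half _ i2_half.
by exists q; rewrite -Dq /= odd_double uphalf_double.
Qed.

(* tau r is the residue of c3 r divided by the unit 12k+13 modulo n; over the
   first half it takes the 24k+23 consecutive values from 4k+4 to 28k+26. *)
Let tau (r : nat) : nat := (if odd r then 16 * k + 16 else 4 * k + 4) + r./2.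

Lemma c3_half (r : nat) : r < n./2 ->
  exists q : int, ((c3 k r)%:Z = (12 * k%:Z + 13) * (tau r)%:Z + q * n%:Z)%R.
Proof.
move=> r_half; rewrite /tau.
have Dr := odd_double_half r.
case: (odd r) Dr => /= Dr; rewrite -{1}Dr ?add1n ?add0n.
  have [|q Dq] := @c3_half_odd r./2; first lia.
  exists (- q%:Z - 4 * k%:Z - 4)%R; rewrite /n in Dq *; lia.
have [|q Dq] := @c3_half_even r./2; first lia.
exists (- q%:Z - k%:Z - 1)%R; rewrite /n in Dq *; lia.
Qed.

Lemma coprime_n_c3 : coprimez n%:Z (12 * k%:Z + 13)%R.
Proof.
(* The inverse of 12k+13 modulo n is 40k+39. *)
apply/coprimezP; exists (- 10 * k%:Z - 11, 40 * k%:Z + 39)%R => /=; rewrite /n; lia.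
Qed.

Lemma c3_latin : latin_square (cyclic_array n (c3 k)).
Proof.
have tau_bd r : r < n./2 -> 4 * k + 4 <= tau r <= 28 * k + 26.
  by rewrite n_half /tau; case: ifP; lia.
have tau_inj r s : r < s < n./2 -> tau r <> tau s.
  rewrite n_half /tau => rs.
  have := odd_double_half r; have := odd_double_half s.
  by case: (odd r); case: (odd s); lia.
apply: reflected_latin => //.
- by move=> r; apply: reflected_columnD.
- move=> r s rs crs.
  have [|qr Dr] := @c3_half r; first lia.
  have [|qs Ds] := @c3_half s; first lia.
  (* Once the unit is cancelled, n divides a difference of two [tau] values, which is smaller than
     n. *)
  have : (n%:Z %| ((12 * k%:Z + 13) * ((tau r)%:Z - (tau s)%:Z))%R)%Z.
    by apply/dvdzP; exists (qs - qr)%R; lia.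
  rewrite Gauss_dvdzr ?coprime_n_c3 // => /dvdz_small_eq0 tau_eq.
  have r_bd : 4 * k + 4 <= tau r <= 28 * k + 26 by apply: tau_bd; lia.
  have s_bd : 4 * k + 4 <= tau s <= 28 * k + 26 by apply: tau_bd; lia.
  by apply: (tau_inj r s rs); have := tau_eq; rewrite /n; lia.
- move=> r s r_half s_half crs.
  have [qr Dr] := c3_half r_half; have [qs Ds] := c3_half s_half.
  (* A sum n - 1 is -1 modulo n; dividing by 12k+13 makes [tau r + tau s] equal to -(40k+39). But
     the bounds on [tau] put the sum below strictly between n and 2n. *)
  have : (n%:Z %| ((12 * k%:Z + 13) *
      ((tau r)%:Z + (tau s)%:Z + (40 * k%:Z + 39)))%R)%Z.
    apply/dvdzP; exists (10 * k%:Z + 12 - qr - qs)%R; rewrite /n in crs Dr Ds *; lia.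
  rewrite Gauss_dvdzr ?coprime_n_c3 //.
  have r_bd := tau_bd r r_half; have s_bd := tau_bd s s_half.
  rewrite -(rpredBr (x := n%:Z)) ?dvdzz // => /dvdz_small_eq0.
  rewrite /n; lia.
Qed.

Lemma c2_latin : latin_square (cyclic_array n (c2 k)).
Proof.
apply: reflected_latin => //.
- by move=> r; apply: reflected_columnD.
- move=> r s rs crs.
  have [|qr Dr] := @c2_half r; first lia.
  have [|qs Ds] := @c2_half s; first lia.
  (* Since 8 * 6(k+1) = n + 2, multiplying the difference of the closed forms by 8 gives 2(s - r) =
     0 modulo n. *)
  have /dvdz_small_eq0 : (n./2%:Z %| (s%:Z - r%:Z)%R)%Z.
    apply/dvdzP; exists (8 * (qs%:Z - qr%:Z) - (s%:Z - r%:Z))%R.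
    by rewrite n_half; rewrite /n in Dr Ds; lia.
  by rewrite n_half in rs *; lia.
- move=> r s r_half s_half crs.
  have [qr Dr] := c2_half r_half; have [qs Ds] := c2_half s_half.
  (* Parity: adding [Dr] and [Ds] equates an even number with a multiple of n plus n + 1, which is
     odd. *)
  rewrite /n in crs Dr Ds; lia.
Qed.

Lemma c1_latin : latin_square (cyclic_array n c1).
Proof.
apply: cyclic_array_latin => r s *.
by rewrite -(@modn_small r n) // -(@modn_small s n).
Qed.

(** * Near orthogonality of the three pairs *)

Let c1D r : r < n -> c1 r + c1 (n.-1 - r) = n.-1. Proof. rewrite /c1; lia. Qed.
Let c2D r : r < n -> c2 k r + c2 k (n.-1 - r) = n.-1.
Proof. exact: reflected_columnD. Qed.
Let c3D r : r < n -> c3 k r + c3 k (n.-1 - r) = n.-1.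
Proof. exact: reflected_columnD. Qed.

Lemma c1_c2_nearly_orthogonal :
  nearly_orthogonal (cyclic_array n c1) (cyclic_array n (c2 k)).
Proof.
apply: (@cyclic_array_nearly_orthogonal _ (6 * k%:Z + 5)%R _ _ predn) => //.
- by apply/coprimezP; exists (- 5 * k%:Z - 4, 40 * k%:Z + 37)%R => /=; rewrite /n; lia.
- exact: c1_latin.
move=> e e_bd; split; first lia.
have [|q Dq] := @c2_half e.-1; first lia.
apply/dvdzP; exists (- q%:Z)%R; rewrite /c1.
have De : e = e.-1.+1 by lia.
rewrite {2}De; lia.
Qed.

Lemma c1_c3_nearly_orthogonal :
  nearly_orthogonal (cyclic_array n c1) (cyclic_array n (c3 k)).
Proof.
(* As i grows, the even rows 2i take e from 12k+12 down to 1, the odd rows from 24k+23 down to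
   12k+13. *)
apply: (@cyclic_array_nearly_orthogonal _ (- 12 * k%:Z - 11)%R _ _
  (fun e => if e <= 12 * k + 12 then (12 * k + 12 - e).*2
            else (24 * k + 23 - e).*2.+1)) => //.
- by apply/coprimezP; exists (- 6 * k%:Z - 5, - 24 * k%:Z - 21)%R => /=; rewrite /n; lia.
- exact: c1_latin.
move=> e; rewrite n_half /c1 => e_bd.
case: ifP => e_le; split; try lia.
- have [|q Dq] := @c3_half_even (12 * k + 12 - e); first lia.
  apply/dvdzP; exists (3 * (k%:Z + 1) - q%:Z)%R; rewrite /n in Dq *.
  have De : e = 12 * k + 12 - (12 * k + 12 - e) by lia.
  by move: (12 * k + 12 - e) De Dq => i De Dq; lia.
- have [|q Dq] := @c3_half_odd (24 * k + 23 - e); first lia.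
  apply/dvdzP; exists (6 * (k%:Z + 1) - q%:Z)%R; rewrite /n in Dq *.
  have De : e = 24 * k + 23 - (24 * k + 23 - e) by lia.
  by move: (24 * k + 23 - e) De Dq => i De Dq; lia.
Qed.

Lemma c2_c3_nearly_orthogonal :
  nearly_orthogonal (cyclic_array n (c2 k)) (cyclic_array n (c3 k)).
Proof.
(* Here e increases with i: from 1 to 12k+12 on even rows, then from 12k+13 to 24k+23 on odd
   rows. *)
apply: (@cyclic_array_nearly_orthogonal _ 1%R _ _
  (fun e => if e <= 12 * k + 12 then (e - 1).*2
            else (e - (12 * k + 13)).*2.+1)) => //.
- by apply/coprimezP; exists (0, 1)%R.
- exact: c2_latin.
move=> e; rewrite n_half => e_bd.
case: ifP => e_le; split; try lia.
- have [i Di] : exists i, e = i + 1 by exists (e - 1); lia.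
  have [|q Dq] := @c3_half_even i; first lia.
  have [|q' Dq'] := @c2_half i.*2; first lia.
  rewrite Di addnK; apply/dvdzP; exists (q'%:Z - q%:Z)%R; rewrite /n in Dq Dq' *; lia.
- have [i Di] : exists i, e = i + (12 * k + 13) by exists (e - (12 * k + 13)); lia.
  have [|q Dq] := @c3_half_odd i; first lia.
  have [|q' Dq'] := @c2_half i.*2.+1; first lia.
  rewrite Di addnK; apply/dvdzP; exists (q'%:Z - q%:Z)%R; rewrite /n in Dq Dq' *; lia.
Qed.

End Columns.

Theorem theorem6 (k : nat) :
  mutually_nearly_orthogonal_latin_squares
    [tuple cyclic_array (48 * k + 46) c1;
           cyclic_array (48 * k + 46) (c2 k);
           cyclic_array (48 * k + 46) (c3 k)].
Proof.
have no12 := c1_c2_nearly_orthogonal k.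
have no13 := c1_c3_nearly_orthogonal k.
have no23 := c2_c3_nearly_orthogonal k.
split=> [[[|[|[|//]]] ?]|[[|[|[|//]]] ?] [[|[|[|//]]] ?]] //.
- exact: c1_latin.
- exact: c2_latin.
- exact: c3_latin.
all: by move=> _; apply: nearly_orthogonal_sym.
Qed.
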